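(* Let $q\in\mathbb{C}$ be non-zero and not a root of unity, let $X=\mathcal{A}(SL_q(2))$ have the 4D bicovariant calculus generated by $\omega^1,\omega^2,\omega^+,\omega^-$, and let $B=\mathcal{A}(S^2_q)=X^{\mathrm{co}H}$. Then all of $\omega^-$, $\omega^+$ and $\omega^1$ are in $\mathrm{d}B.X$ (the linear span of the elements $\mathrm{d}b.x$ with $b\in B$, $x\in X$).
   Context: $X=\mathcal{A}(SL_q(2))$ is the complex Hopf algebra generated by $\alpha,\beta,\gamma,\delta$ with relations $\alpha\beta=q\beta\alpha$, $\alpha\gamma=q\gamma\alpha$, $\beta\gamma=\gamma\beta$, $\beta\delta=q\delta\beta$, $\gamma\delta=q\delta\gamma$, $\alpha\delta=\delta\alpha+(q-q^{-1})\beta\gamma$, $\alpha\delta-q\beta\gamma=1$; coproduct $\Delta\alpha=\alpha\otimes\alpha+\beta\otimes\gamma$, $\Delta\beta=\alpha\otimes\beta+\beta\otimes\delta$, $\Delta\gamma=\gamma\otimes\alpha+\delta\otimes\gamma$, $\Delta\delta=\delta\otimes\delta+\gamma\otimes\beta$; antipode $S(\alpha)=\delta$, $S(\delta)=\alpha$, $S(\beta)=-q^{-1}\beta$, $S(\gamma)=-q\gamma$. $H=\mathbb{C}[z,z^{-1}]$ with $z$ grouplike. The right coaction $\rho:X\to X\otimes H$ is the algebra map with $\rho(\alpha)=\alpha\otimes z$, $\rho(\beta)=\beta\otimes z^{-1}$, $\rho(\gamma)=\gamma\otimes z$, $\rho(\delta)=\delta\otimes z^{-1}$. $B=\{b\in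 X:\rho(b)=b\otimes1\}$ is the subalgebra generated by $\alpha\beta,\alpha\delta,\gamma\delta$. The 4D calculus (Woronowicz): $\Omega^1X$ is the $X$-bimodule, free as a left $X$-module on left invariant 1-forms $\omega^1,\omega^2,\omega^+,\omega^-$, with derivation $\mathrm{d}:X\to\Omega^1X$ given by $\mathrm{d}\alpha=\frac{q-q^{-1}-q^{-2}}{q+1}\alpha\omega^1-q^{-2}\beta\omega^++\frac{q^{-1}}{q+1}\alpha\omega^2$, $\mathrm{d}\beta=\frac{q}{q+1}\beta\omega^1-q^{-2}\alpha\omega^--\frac{q^{-2}}{q+1}\beta\omega^2$, $\mathrm{d}\gamma=\frac{q-q^{-1}-q^{-2}}{q+1}\gamma\omega^1-q^{-2}\delta\omega^++\frac{q^{-1}}{q+1}\gamma\omega^2$, $\mathrm{d}\delta=\frac{q}{q+1}\delta\omega^1-q^{-2}\gamma\omega^--\frac{q^{-2}}{q+1}\delta\omega^2$, and commutation relations $\omega^2\alpha=q\alpha\omega^2-(q-q^{-1})\beta\omega^++q(q-q^{-1})^2\alpha\omega^1$, $\omega^2\beta=q^{-1}\beta\omega^2-(q-q^{-1})\alpha\omega^-$, $\omega^-\alpha=\alpha\omega^--(q^2-1)\beta\omega^1$, $\omega^-\beta=\beta\omega^-$, $\omega^+\alpha=\alpha\omega^+$, $\omega^+\beta=\beta\omega^+-(q^2-1)\alpha\omega^1$, $\omega^1\alpha=q^{-1}\alpha\omega^1$, $\omega^1\beta=q\beta\omega^1$, together with the same relations with $\alpha\to\gamma$, $\beta\to\delta$.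 *)

(* Defs.v *)
From HB Require Import structures.
From mathcomp Require Import all_boot all_order all_algebra generic_quotient.
From mathcomp Require Import boolp reals.
From mathcomp Require Export complex.

Set Implicit Arguments.
Unset Strict Implicit.
Unset Printing Implicit Defensive.

Import GRing.Theory.
Local Open Scope ring_scope.
Local Open Scope quotient_scope.

(* The unital associative algebra K<I | rel> given by generators and
   relations, as the quotient of the noncommutative polynomial expressions by
   the least congruence that contains rel and the K-algebra axioms. The
   additive inverse is multiplication by the constant -1. *)

Declare Scope term_scope.
Delimit Scope term_scope with term.

Inductive term (K I : Type) : Type :=
| Gen of I
| Cst of K
| Add of term K I & term K I
| Mul of term K I & term K I.
Arguments Gen {K I} i.
Arguments Cst {K I} c.
Bind Scope term_scope with term.

Notation "s + t" := (Add s t) : term_scope.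
Notation "s * t" := (Mul s t) : term_scope.

HB.instance Definition _ (K I : Type) := gen_eqMixin (term K I).
HB.instance Definition _ (K I : Type) := gen_choiceMixin (term K I).

Section Presentation.
Variables (K : comNzRingType) (I : Type).
Variable rel : term K I -> term K I -> Prop.
Local Notation tm := (term K I).

Inductive cong : tm -> tm -> Prop :=
| cong_rel s t of rel s t : cong s t
| cong_refl t : cong t t
| cong_sym s t of cong s t : cong t s
| cong_trans s t u of cong s t & cong t u : cong s u
| congD s s' t t' of cong s s' & cong t t' : cong (s + t) (s' + t')
| congM s s' t t' of cong s s' & cong t t' : cong (s * t) (s' * t')
| cong_addA s t u : cong (s + (t + u)) (s + t + u)
| cong_addC s t : cong (s + t) (t + s)
| cong_add0 t : cong (Cst 0 + t) t
| cong_mulA s t u : cong (s * (t * u)) (s * t * u)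
| cong_mul1 t : cong (Cst 1 * t) t
| cong_mul0 t : cong (Cst 0 * t) (Cst 0)
| cong_mulDl s t u : cong ((s + t) * u) (s * u + t * u)
| cong_mulDr s t u : cong (s * (t + u)) (s * t + s * u)
| cong_cstD a b : cong (Cst (a + b)) (Cst a + Cst b)
| cong_cstM a b : cong (Cst (a * b)) (Cst a * Cst b)
| cong_cstC a t : cong (Cst a * t) (t * Cst a).

Definition congb (s t : tm) : bool := `[< cong s t >].

Lemma congb_equiv : equiv_class_of congb.
Proof.
split.
- by move=> t; apply/asboolP/cong_refl.
- by move=> s t; apply/asboolP/asboolP; apply: cong_sym.
- by move=> t s u /asboolP st /asboolP tu; apply/asboolP/(cong_trans st tu).
Qed.

Canonical cong_equiv_rel := EquivRelPack congb_equiv.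

Definition presented := {eq_quot cong_equiv_rel}.
HB.instance Definition _ := Choice.on presented.
HB.instance Definition _ := EqQuotient.on presented.

Definition class_of (t : tm) : presented := \pi t.

Lemma class_of_eq s t : cong s t -> class_of s = class_of t.
Proof. by move=> st; apply/eqmodP/asboolP. Qed.

Lemma cong_repr t : cong (repr (class_of t)) t.
Proof.
apply/asboolP; have /eqmodP // : repr (class_of t) = t %[mod presented].
by rewrite reprK.
Qed.

Lemma class_of_repr (x : presented) : class_of (repr x) = x.
Proof. exact: reprK. Qed.

Definition pres_gen (i : I) : presented := class_of (Gen i).
Definition pres_cst (c : K) : presented := class_of (Cst c).
Definition pres_add (x y : presented) := class_of (repr x + repr y).
Definition pres_mul (x y : presented) := class_of (repr x * repr y).
Definition pres_opp (x : presented) := pres_mul (pres_cst (- 1)) x.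

Lemma pres_addE s t :
  pres_add (class_of s) (class_of t) = class_of (s + t)%term.
Proof. by apply/class_of_eq/congD; apply: cong_repr. Qed.

Lemma pres_mulE s t :
  pres_mul (class_of s) (class_of t) = class_of (s * t)%term.
Proof. by apply/class_of_eq/congM; apply: cong_repr. Qed.

Lemma pres_addA : associative pres_add.
Proof.
move=> x y z; rewrite -(class_of_repr x) -(class_of_repr y) -(class_of_repr z).
by rewrite !pres_addE; apply/class_of_eq/cong_addA.
Qed.

Lemma pres_addC : commutative pres_add.
Proof. by move=> x y; apply/class_of_eq/cong_addC. Qed.

Lemma pres_add0 : left_id (pres_cst 0) pres_add.
Proof.
move=> x; rewrite -(class_of_repr x) pres_addE.
exact/class_of_eq/cong_add0.
Qed.

Lemma pres_mulA : associative pres_mul.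
Proof.
move=> x y z; rewrite -(class_of_repr x) -(class_of_repr y) -(class_of_repr z).
by rewrite !pres_mulE; apply/class_of_eq/cong_mulA.
Qed.

Lemma pres_mul1l : left_id (pres_cst 1) pres_mul.
Proof.
move=> x; rewrite -(class_of_repr x) pres_mulE.
exact/class_of_eq/cong_mul1.
Qed.

Lemma pres_cstC c x : pres_mul (pres_cst c) x = pres_mul x (pres_cst c).
Proof.
rewrite -(class_of_repr x) !pres_mulE; exact/class_of_eq/cong_cstC.
Qed.

Lemma pres_mul1r : right_id (pres_cst 1) pres_mul.
Proof. by move=> x; rewrite -pres_cstC pres_mul1l. Qed.

Lemma pres_mul0l x : pres_mul (pres_cst 0) x = pres_cst 0.
Proof.
rewrite -(class_of_repr x) pres_mulE; exact/class_of_eq/cong_mul0.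
Qed.

Lemma pres_mulDl : left_distributive pres_mul pres_add.
Proof.
move=> x y z; rewrite -(class_of_repr x) -(class_of_repr y) -(class_of_repr z).
by rewrite !(pres_mulE, pres_addE); apply/class_of_eq/cong_mulDl.
Qed.

Lemma pres_mulDr : right_distributive pres_mul pres_add.
Proof.
move=> x y z; rewrite -(class_of_repr x) -(class_of_repr y) -(class_of_repr z).
by rewrite !(pres_mulE, pres_addE); apply/class_of_eq/cong_mulDr.
Qed.

Lemma pres_cstD a b : pres_cst (a + b) = pres_add (pres_cst a) (pres_cst b).
Proof. by rewrite pres_addE; apply/class_of_eq/cong_cstD. Qed.

Lemma pres_cstM a b : pres_cst (a * b) = pres_mul (pres_cst a) (pres_cst b).
Proof. by rewrite pres_mulE; apply/class_of_eq/cong_cstM. Qed.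

Lemma pres_addN : left_inverse (pres_cst 0) pres_opp pres_add.
Proof.
move=> x; rewrite /pres_opp -{2}(pres_mul1l x) -pres_mulDl -pres_cstD.
by rewrite addNr pres_mul0l.
Qed.

HB.instance Definition _ :=
  GRing.isZmodule.Build presented pres_addA pres_addC pres_add0 pres_addN.
HB.instance Definition _ := GRing.Zmodule_isPzRing.Build presented
  pres_mulA pres_mul1l pres_mul1r pres_mulDl pres_mulDr.

Definition pres_scale (c : K) (x : presented) : presented := pres_cst c * x.

Lemma pres_scaleA a b x :
  pres_scale a (pres_scale b x) = pres_scale (a * b) x.
Proof. by rewrite /pres_scale mulrA; congr (_ * _); rewrite pres_cstM. Qed.

Lemma pres_scale1 : left_id 1 pres_scale.
Proof. exact: pres_mul1l. Qed.

Lemma pres_scaleDr : right_distributive pres_scale +%R.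
Proof. by move=> c x y; rewrite /pres_scale mulrDr. Qed.

Lemma pres_scaleDl x : {morph pres_scale^~ x : a b / a + b}.
Proof.
by move=> a b; rewrite /pres_scale -mulrDl; congr (_ * _); rewrite pres_cstD.
Qed.

HB.instance Definition _ := GRing.Zmodule_isLmodule.Build K presented
  pres_scaleA pres_scale1 pres_scaleDr pres_scaleDl.

Lemma pres_scaleE c (x : presented) : c *: x = pres_cst c * x.
Proof. by []. Qed.

Lemma pres_scalerAl c (x y : presented) : c *: (x * y) = c *: x * y.
Proof. exact: mulrA. Qed.

Lemma pres_scalerAr c (x y : presented) : c *: (x * y) = x * (c *: y).
Proof.
rewrite !pres_scaleE !mulrA; congr (_ * _); exact: pres_cstC.
Qed.

Lemma class_ofD s t : class_of (s + t)%term = class_of s + class_of t.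
Proof. by rewrite -pres_addE. Qed.

Lemma class_ofM s t : class_of (s * t)%term = class_of s * class_of t.
Proof. by rewrite -pres_mulE. Qed.

Lemma class_of_cst c : class_of (Cst c) = c *: (1 : presented).
Proof. by rewrite pres_scaleE mulr1. Qed.

(* Universal property: maps out of the presented algebra into a ring S that
   receives K centrally along io. *)
Section Lift.
Variables (S : pzRingType) (io : K -> S) (f : I -> S).

Fixpoint teval (t : tm) : S :=
  match t with
  | Gen i => f i
  | Cst c => io c
  | Add s t => teval s + teval t
  | Mul s t => teval s * teval t
  end.

Definition lift (x : presented) : S := teval (repr x).

Hypothesis io0 : io 0 = 0.
Hypothesis io1 : io 1 = 1.
Hypothesis ioD : {morph io : a b / a + b}.
Hypothesis ioM : {morph io : a b / a * b}.
Hypothesis ioC : forall c s, io c * s = s * io c.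
Hypothesis frel : forall s t, rel s t -> teval s = teval t.

Lemma teval_cong s t : cong s t -> teval s = teval t.
Proof.
elim=> {s t} /=.
- exact: frel.
- by [].
- by [].
- by move=> s t u _ -> _ ->.
- by move=> s s' t t' _ -> _ ->.
- by move=> s s' t t' _ -> _ ->.
- by move=> s t u; rewrite addrA.
- by move=> s t; rewrite addrC.
- by move=> t; rewrite io0 add0r.
- by move=> s t u; rewrite mulrA.
- by move=> t; rewrite io1 mul1r.
- by move=> t; rewrite io0 mul0r.
- by move=> s t u; rewrite mulrDl.
- by move=> s t u; rewrite mulrDr.
- exact: ioD.
- exact: ioM.
- by move=> c t; rewrite ioC.
Qed.

Lemma lift_class t : lift (class_of t) = teval t.
Proof. exact/teval_cong/cong_repr. Qed.

Lemma lift_gen i : lift (pres_gen i) = f i.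
Proof. exact: lift_class. Qed.

Lemma liftD : {morph lift : x y / x + y}.
Proof. by move=> x y; rewrite -[x + y]/(class_of _) lift_class. Qed.

Lemma liftM : {morph lift : x y / x * y}.
Proof. by move=> x y; rewrite -[x * y]/(class_of _) lift_class. Qed.

Lemma lift1 : lift 1 = 1.
Proof. by rewrite -[1 in LHS]/(class_of _) lift_class. Qed.

Lemma liftB : {morph lift : x y / x - y}.
Proof.
move=> x y; apply/eqP; rewrite -subr_eq opprK -liftD.
by rewrite subrK.
Qed.

Lemma liftZ c x : lift (c *: x) = io c * lift x.
Proof. by rewrite pres_scaleE liftM; congr (_ * _); apply: lift_class. Qed.

End Lift.

End Presentation.

Arguments pres_gen {K I} rel i.

Section Nontrivial.
Variables (K : comNzRingType) (I : Type).
Variable rel : term K I -> term K I -> Prop.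

(* MathComp algebras are nontrivial rings: a K-valued point suffices. *)
Lemma pres_oner_neq0 (f : I -> K) :
  (forall s t, rel s t -> teval idfun f s = teval idfun f t) ->
  1 != 0 :> presented rel.
Proof.
move=> frel; apply/eqP => /(congr1 (lift idfun f)).
rewrite -[1]/(class_of rel (Cst 1)) -[0]/(class_of rel (Cst 0)).
rewrite !lift_class //=; last first.
- by move=> c s; rewrite mulrC.
- by move=> c s; rewrite mulrC.
by move/eqP; rewrite oner_eq0.
Qed.

End Nontrivial.

(* A (x) B, as the algebra generated by the symbols a (x) b subject to
   bilinearity and (a (x) b)(a' (x) b') = aa' (x) bb'. *)
Section TensorProduct.
Variables (K : comNzRingType) (A B : algType K).

Inductive tens_rel : term K (A * B) -> term K (A * B) -> Prop :=
| tens_rel1 : tens_rel (Gen (1, 1)) (Cst 1)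
| tens_relDl a a' b :
    tens_rel (Gen (a + a', b)) (Gen (a, b) + Gen (a', b))
| tens_relDr a b b' :
    tens_rel (Gen (a, b + b')) (Gen (a, b) + Gen (a, b'))
| tens_relZl c a b : tens_rel (Gen (c *: a, b)) (Cst c * Gen (a, b))
| tens_relZr c a b : tens_rel (Gen (a, c *: b)) (Cst c * Gen (a, b))
| tens_relM a a' b b' :
    tens_rel (Gen (a, b) * Gen (a', b')) (Gen (a * a', b * b')).

Definition tensor := presented tens_rel.
HB.instance Definition _ := GRing.PzRing.on tensor.
HB.instance Definition _ := GRing.Lmodule.on tensor.

Definition tens (a : A) (b : B) : tensor := pres_gen tens_rel (a, b).

Lemma tens11 : tens 1 1 = 1.
Proof. by apply: class_of_eq; apply: cong_rel; constructor. Qed.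

Lemma tensDl a a' b : tens (a + a') b = tens a b + tens a' b.
Proof.
by rewrite -class_ofD; apply: class_of_eq; apply: cong_rel; constructor.
Qed.

Lemma tensDr a b b' : tens a (b + b') = tens a b + tens a b'.
Proof.
by rewrite -class_ofD; apply: class_of_eq; apply: cong_rel; constructor.
Qed.

Lemma tensZl c a b : tens (c *: a) b = c *: tens a b.
Proof.
rewrite pres_scaleE -class_ofM.
by apply: class_of_eq; apply: cong_rel; constructor.
Qed.

Lemma tensZr c a b : tens a (c *: b) = c *: tens a b.
Proof.
rewrite pres_scaleE -class_ofM.
by apply: class_of_eq; apply: cong_rel; constructor.
Qed.

Lemma tensM a a' b b' : tens a b * tens a' b' = tens (a * a') (b * b').
Proof.
by rewrite -class_ofM; apply: class_of_eq; apply: cong_rel; constructor.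
Qed.

Lemma tensor_scalerAl c (x y : tensor) : c *: (x * y) = c *: x * y.
Proof. exact: pres_scalerAl. Qed.

Lemma tensor_scalerAr c (x y : tensor) : c *: (x * y) = x * (c *: y).
Proof. exact: pres_scalerAr. Qed.

End TensorProduct.

(* The coordinate algebra A(SL_q(2)). *)
Inductive sl_gen := Alpha | Beta | Gamma | Delta.

Section SLq2.
Variables (K : fieldType) (q : K).

Local Notation "'a'" := (Gen Alpha) : term_scope.
Local Notation "'b'" := (Gen Beta) : term_scope.
Local Notation "'c'" := (Gen Gamma) : term_scope.
Local Notation "'d'" := (Gen Delta) : term_scope.

Inductive sl_rel : term K sl_gen -> term K sl_gen -> Prop :=
| sl_ab : sl_rel (a * b) (Cst q * (b * a))
| sl_ac : sl_rel (a * c) (Cst q * (c * a))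
| sl_bc : sl_rel (b * c) (c * b)
| sl_bd : sl_rel (b * d) (Cst q * (d * b))
| sl_cd : sl_rel (c * d) (Cst q * (d * c))
| sl_ad : sl_rel (a * d) (d * a + Cst (q - q^-1) * (b * c))
| sl_det : sl_rel (a * d + Cst (- q) * (b * c)) (Cst 1).

Definition SLq2 := presented sl_rel.
HB.instance Definition _ := GRing.PzRing.on SLq2.
HB.instance Definition _ := GRing.Lmodule.on SLq2.

Lemma SLq2_oner_neq0 : 1 != 0 :> SLq2.
Proof.
pose f i : K := match i with Alpha | Delta => 1 | _ => 0 end.
apply: (@pres_oner_neq0 _ _ _ f) => s t [] /=;
  by rewrite ?(mulr0, mul0r, mulr1, addr0).
Qed.

HB.instance Definition _ :=
  GRing.PzSemiRing_isNonZero.Build SLq2 SLq2_oner_neq0.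
HB.instance Definition _ :=
  GRing.Lmodule_isLalgebra.Build K SLq2 (@pres_scalerAl K sl_gen sl_rel).
HB.instance Definition _ :=
  GRing.Lalgebra_isAlgebra.Build K SLq2 (@pres_scalerAr K sl_gen sl_rel).

Definition alpha : SLq2 := pres_gen sl_rel Alpha.
Definition beta : SLq2 := pres_gen sl_rel Beta.
Definition gamma : SLq2 := pres_gen sl_rel Gamma.
Definition delta : SLq2 := pres_gen sl_rel Delta.

Lemma SLq2_ab : alpha * beta = q *: (beta * alpha).
Proof.
rewrite -!class_ofM pres_scaleE -class_ofM.
by apply: class_of_eq; apply: cong_rel; constructor.
Qed.

Lemma SLq2_ac : alpha * gamma = q *: (gamma * alpha).
Proof.
rewrite -!class_ofM pres_scaleE -class_ofM.
by apply: class_of_eq; apply: cong_rel; constructor.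
Qed.

Lemma SLq2_bc : beta * gamma = gamma * beta.
Proof.
by rewrite -!class_ofM; apply: class_of_eq; apply: cong_rel; constructor.
Qed.

Lemma SLq2_bd : beta * delta = q *: (delta * beta).
Proof.
rewrite -!class_ofM pres_scaleE -class_ofM.
by apply: class_of_eq; apply: cong_rel; constructor.
Qed.

Lemma SLq2_cd : gamma * delta = q *: (delta * gamma).
Proof.
rewrite -!class_ofM pres_scaleE -class_ofM.
by apply: class_of_eq; apply: cong_rel; constructor.
Qed.

Lemma SLq2_ad : alpha * delta = delta * alpha + (q - q^-1) *: (beta * gamma).
Proof.
rewrite -!class_ofM pres_scaleE -class_ofM -class_ofD.
by apply: class_of_eq; apply: cong_rel; constructor.
Qed.

Lemma SLq2_det : alpha * delta - q *: (beta * gamma) = 1.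
Proof.
rewrite -scaleNr -!class_ofM pres_scaleE -class_ofM -class_ofD.
by apply: class_of_eq; apply: cong_rel; constructor.
Qed.

End SLq2.

Arguments alpha {K} q.
Arguments beta {K} q.
Arguments gamma {K} q.
Arguments delta {K} q.

(* H = K[z, z^-1]. *)
Section Laurent.
Variable K : fieldType.

Inductive laurent_gen := Zgen | Zinv.

Inductive laurent_rel : term K laurent_gen -> term K laurent_gen -> Prop :=
| laurent_zV : laurent_rel (Gen Zgen * Gen Zinv) (Cst 1)
| laurent_Vz : laurent_rel (Gen Zinv * Gen Zgen) (Cst 1).

Definition laurent := presented laurent_rel.
HB.instance Definition _ := GRing.PzRing.on laurent.
HB.instance Definition _ := GRing.Lmodule.on laurent.

Lemma laurent_oner_neq0 : 1 != 0 :> laurent.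
Proof.
by apply: (@pres_oner_neq0 _ _ _ (fun=> 1)) => s t [] /=; rewrite mulr1.
Qed.

HB.instance Definition _ :=
  GRing.PzSemiRing_isNonZero.Build laurent laurent_oner_neq0.
HB.instance Definition _ := GRing.Lmodule_isLalgebra.Build K laurent
  (@pres_scalerAl K laurent_gen laurent_rel).
HB.instance Definition _ := GRing.Lalgebra_isAlgebra.Build K laurent
  (@pres_scalerAr K laurent_gen laurent_rel).

Definition zeta : laurent := pres_gen laurent_rel Zgen.
Definition zeta_inv : laurent := pres_gen laurent_rel Zinv.

Lemma zetaV : zeta * zeta_inv = 1.
Proof.
by rewrite -class_ofM; apply: class_of_eq; apply: cong_rel; constructor.
Qed.

Lemma zetaVl : zeta_inv * zeta = 1.
Proof.
by rewrite -class_ofM; apply: class_of_eq; apply: cong_rel; constructor.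
Qed.

End Laurent.

Arguments zeta {K}.
Arguments zeta_inv {K}.

Section Coaction.
Variables (K : fieldType) (q : K).
Local Notation X := (SLq2 q).
Local Notation H := (laurent K).
Local Notation XH := (tensor X H).
Local Notation "x ⊗ h" := (@tens K X H x h) (at level 38) : ring_scope.

Definition rho_gen (i : sl_gen) : XH :=
  match i with
  | Alpha => alpha q ⊗ zeta
  | Beta => beta q ⊗ zeta_inv
  | Gamma => gamma q ⊗ zeta
  | Delta => delta q ⊗ zeta_inv
  end.

Definition rho : X -> XH := lift (fun c => c *: (1 : XH)) rho_gen.

Let io (c : K) : XH := c *: (1 : XH).

Fact io0 : io 0 = 0. Proof. exact: scale0r. Qed.
Fact io1 : io 1 = 1. Proof. exact: scale1r. Qed.
Fact ioD : {morph io : a b / a + b}.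
Proof. by move=> a b; apply: scalerDl. Qed.
Fact ioE c (x : XH) : io c * x = c *: x.
Proof. by rewrite -tensor_scalerAl mul1r. Qed.
Fact ioM : {morph io : a b / a * b}.
Proof. by move=> a b; rewrite ioE scalerA. Qed.
Fact ioC c (x : XH) : io c * x = x * io c.
Proof. by rewrite ioE -tensor_scalerAr mulr1. Qed.

Fact rho_rel s t :
  sl_rel q s t -> teval io rho_gen s = teval io rho_gen t.
Proof.
case=> /=; rewrite ?ioE ?tensM.
- by rewrite SLq2_ab zetaV zetaVl tensZl.
- by rewrite SLq2_ac tensZl.
- by rewrite SLq2_bc zetaV zetaVl.
- by rewrite SLq2_bd tensZl.
- by rewrite SLq2_cd zetaV zetaVl tensZl.
- by rewrite zetaV zetaVl SLq2_ad tensDl tensZl.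
- by rewrite zetaV zetaVl -tensZl -tensDl scaleNr SLq2_det tens11 io1.
Qed.

Fact rho_is_zmod_morphism : zmod_morphism rho.
Proof. exact: (liftB io0 io1 ioD ioM ioC rho_rel). Qed.

Fact rho_is_monoid_morphism : monoid_morphism rho.
Proof.
split; first by rewrite /rho (lift1 io0 io1 ioD ioM ioC rho_rel).
exact: (liftM io0 io1 ioD ioM ioC rho_rel).
Qed.

Fact rho_is_scalable : scalable rho.
Proof.
by move=> c x; rewrite /rho (liftZ io0 io1 ioD ioM ioC rho_rel) ioE.
Qed.

HB.instance Definition _ :=
  GRing.isZmodMorphism.Build X XH rho rho_is_zmod_morphism.
HB.instance Definition _ :=
  GRing.isMonoidMorphism.Build X XH rho rho_is_monoid_morphism.
HB.instance Definition _ :=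
  GRing.isScalable.Build K X XH *:%R rho rho_is_scalable.

Lemma rho_generators :
  [/\ rho (alpha q) = alpha q ⊗ zeta, rho (beta q) = beta q ⊗ zeta_inv,
      rho (gamma q) = gamma q ⊗ zeta & rho (delta q) = delta q ⊗ zeta_inv].
Proof.
by split; apply: (lift_gen io0 io1 ioD ioM ioC rho_rel).
Qed.

Definition coinvariant (b : X) : Prop := rho b = b ⊗ 1.

End Coaction.

(* Bimodules over a K-algebra A on which both actions of K agree. *)
Record bimodule (K : fieldType) (A : algType K) := Bimodule {
  bim_lmod :> lmodType A;
  ract : bim_lmod -> A -> bim_lmod;
  ract1 : forall w, ract w 1 = w;
  ractA : forall w x y, ract (ract w x) y = ract w (x * y);
  ractDl : forall w w' x, ract (w + w') x = ract w x + ract w' x;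
  ractDr : forall w x y, ract w (x + y) = ract w x + ract w y;
  ract_scaler : forall x w y, ract (x *: w) y = x *: ract w y;
  ract_central : forall w (c : K), ract w c%:A = c%:A *: w
}.

Notation "w *> x" := (ract w x) (at level 40, left associativity) : ring_scope.

Definition left_basis (A : pzRingType) (M : lmodType A) n (e : n.-tuple M) :=
  forall w : M, exists! c : {ffun 'I_n -> A}, w = \sum_i c i *: tnth e i.

Section Calculus.
Variables (K : fieldType) (q : K).
Local Notation X := (SLq2 q).

(* Used at (a, b) = (alpha, beta) and (a, b) = (gamma, delta); K acts on the
   bimodule through c%:A. *)
Definition comm_rels (Omega : bimodule X) (w1 w2 wp wm : Omega)
    (a b : X) : Prop :=
  [/\ w2 *> a = (q *: a) *: w2 - ((q - q^-1) *: b) *: wp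
                + ((q * (q - q^-1) ^+ 2) *: a) *: w1
    /\ w2 *> b = (q^-1 *: b) *: w2 - ((q - q^-1) *: a) *: wm,
      wm *> a = a *: wm - ((q ^+ 2 - 1) *: b) *: w1 /\ wm *> b = b *: wm,
      wp *> a = a *: wp /\ wp *> b = b *: wp - ((q ^+ 2 - 1) *: a) *: w1
    & w1 *> a = (q^-1 *: a) *: w1 /\ w1 *> b = (q *: b) *: w1].

Definition diff_rels (Omega : bimodule X) (d : X -> Omega)
    (w1 w2 wp wm : Omega) (a b : X) : Prop :=
  d a = (((q - q^-1 - q ^- 2) / (q + 1)) *: a) *: w1 - (q ^- 2 *: b) *: wp
        + ((q^-1 / (q + 1)) *: a) *: w2
  /\ d b = ((q / (q + 1)) *: b) *: w1 - (q ^- 2 *: a) *: wm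
           - ((q ^- 2 / (q + 1)) *: b) *: w2.

Record calculus4D := Calculus4D {
  Omega :> bimodule X;
  dX : X -> Omega;
  dXD : forall x y, dX (x + y) = dX x + dX y;
  dXZ : forall (c : K) x, dX (c *: x) = c%:A *: dX x;
  dXM : forall x y, dX (x * y) = dX x *> y + x *: dX y;
  omega1 : Omega;
  omega2 : Omega;
  omegap : Omega;
  omegam : Omega;
  omega_basis : left_basis [tuple omega1; omega2; omegap; omegam];
  dX_ab : diff_rels dX omega1 omega2 omegap omegam (alpha q) (beta q);
  dX_cd : diff_rels dX omega1 omega2 omegap omegam (gamma q) (delta q);
  omega_ab : comm_rels omega1 omega2 omegap omegam (alpha q) (beta q);
  omega_cd : comm_rels omega1 omega2 omegap omegam (gamma q) (delta q)
}.

(* The K-linear span of the elements (dX b) *> x with b coinvariant. *)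
Definition dB_X (C : calculus4D) (w : C) : Prop :=
  exists n (c : 'I_n -> K) (b x : 'I_n -> X),
    (forall i, coinvariant (b i)) /\
    w = \sum_(i < n) (c i)%:A *: (dX C (b i) *> x i).

End Calculus.

(* Main.v *)
Require Import Defs.
From mathcomp Require Import all_boot all_order all_algebra.
From mathcomp Require Import reals complex.
From mathcomp Require Import ring.

(** The entries of a row [(a, b)] of the matrix [(α β; γ δ)] obey the same
    structure relations whichever row is taken, so the differential of every
    product of an entry [a] of the first column by an entry [b'] of the second,
    with [(a', b')] the row of [b'], is given by one bilinear formula.  Written
    with all coefficients on the right it reads ([dX_rowM], [λ = q - q^-1])

      d (a b') = - λ ω¹ (a b' + q^-1 b a') - q^-2 ω⁺ b b' - q^-1 ω⁻ a a',

    the terms in ω² having cancelled.  The four such products [αβ], [αδ], [γβ],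
    [γδ] are coinvariant, because [α], [γ] have degree [z] and [β], [δ] degree
    [z^-1].

    As [dB.X] is a right [X]-submodule, these four forms may be combined with
    right coefficients so as to invert the matrix [(α β; γ δ)].  The inverse
    needed here has entries [S^-1(t_ki)]: the columns [(δ, - q β)] and
    [(- q^-1 γ, α)] satisfy

      α δ - γ q β = 1,        β δ - δ q β = 0,
      - α q^-1 γ + γ α = 0,   - β q^-1 γ + δ α = 1.

    Contracting the index of the second factor with either column
    ([dB_X_contract]) leaves, up to invertible scalars, the forms
    [λ ω¹ b + ω⁻ a] and [q² λ ω¹ a + ω⁺ b] for both rows [(a, b)]; contracting
    the remaining index gives [ω⁻] and [λ ω¹] from the former, and [ω⁺] from
    the latter.  That [q] is not a square root of 1 makes [λ] and [q + 1], which
    occurs as a denominator in the differential, invertible. *)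

Set Implicit Arguments.
Unset Strict Implicit.
Unset Printing Implicit Defensive.

Import GRing.Theory.
Local Open Scope ring_scope.
Local Open Scope complex_scope.

(** * Right actions *)

Section Bimodules.
Variables (K : fieldType) (A : algType K) (M : bimodule A).
Implicit Types (w : M) (x : A) (c : K).

Lemma ract0 w : w *> 0 = 0.
Proof. by apply: (addrI (w *> 0)); rewrite -ractDr !addr0. Qed.

Lemma ract0l x : (0 : M) *> x = 0.
Proof. by apply: (addrI ((0 : M) *> x)); rewrite -ractDl !addr0. Qed.

(** Scalars act centrally, so they may be kept inside right coefficients: this
    lets all scalar bookkeeping take place in the algebra. *)
Lemma ractZr w c x : w *> (c *: x) = c%:A *: (w *> x).
Proof.
by rewrite -[in LHS](mul1r x) scalerAl -ractA ract_central ract_scaler.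
Qed.

Lemma ract_suml n (F : 'I_n -> M) x :
  (\sum_(i < n) F i) *> x = \sum_(i < n) F i *> x.
Proof.
by elim/big_rec2: _ => [|i w v _ <-]; rewrite ?ract0l ?ractDl.
Qed.

End Bimodules.

(** * Linear combinations of two vectors *)

Section LinearCombination.
Variables (K : fieldType) (V : lmodType K) (u v : V).
Implicit Types c e : K.

(** Locked, so that the rules below apply only to combinations already put in
    this form and together compute coefficients. *)
Definition lin2 c e := locked (c *: u + e *: v).

Lemma lin2l c : c *: u = lin2 c 0.
Proof. by rewrite /lin2 -!lock scale0r addr0. Qed.

Lemma lin2r e : e *: v = lin2 0 e.
Proof. by rewrite /lin2 -!lock scale0r add0r. Qed.

Lemma lin2D c e c' e' : lin2 c e + lin2 c' e' = lin2 (c + c') (e + e').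
Proof. by rewrite /lin2 -!lock !scalerDl addrACA. Qed.

Lemma lin2Z k c e : k *: lin2 c e = lin2 (k * c) (k * e).
Proof. by rewrite /lin2 -!lock scalerDr !scalerA. Qed.

Lemma lin2N c e : - lin2 c e = lin2 (- c) (- e).
Proof. by rewrite /lin2 -!lock opprD !scaleNr. Qed.

End LinearCombination.

(** * The right submodule dB.X *)

Section Calculus.
Variables (K : fieldType) (q : K).
Hypotheses (q_neq0 : q != 0) (q2_neq1 : q ^+ 2 != 1).
Variable C : calculus4D q.

Local Notation X := (SLq2 q).
Local Notation d := (dX C).
Local Notation w1 := (omega1 C).
Local Notation w2 := (omega2 C).
Local Notation wp := (omegap C).
Local Notation wm := (omegam C).
Local Notation α := (alpha q).
Local Notation β := (beta q).
Local Notation γ := (gamma q).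
Local Notation δ := (delta q).
Local Notation λ := (q - q^-1).

Lemma q1_neq0 : q + 1 != 0.
Proof.
apply: contraNneq q2_neq1 => /eqP; rewrite addr_eq0 => /eqP ->.
by rewrite sqrrN expr1n.
Qed.

Lemma lambda_neq0 : λ != 0.
Proof.
by apply: contraNneq q2_neq1 => /subr0_eq qV; rewrite expr2 {2}qV divff.
Qed.

Lemma dB_X_d (b : X) : coinvariant b -> dB_X (d b).
Proof.
move=> bB; exists 1%N, (fun=> 1), (fun=> b), (fun=> 1); split=> //.
by rewrite big_ord1 ract1 !scale1r.
Qed.

Lemma dB_XD (v w : C) : dB_X v -> dB_X w -> dB_X (v + w).
Proof.
move=> [m [c [b [x [bB ->]]]]] [n [c' [b' [x' [b'B ->]]]]].
pose cat T (f : 'I_m -> T) (g : 'I_n -> T) i :=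
  match split i with inl j => f j | inr j => g j end.
have catl T (f : 'I_m -> T) g i : cat T f g (lshift n i) = f i.
  by rewrite /cat -[lshift n i]/(unsplit (inl i)) unsplitK.
have catr T (f : 'I_m -> T) g i : cat T f g (rshift m i) = g i.
  by rewrite /cat -[rshift m i]/(unsplit (inr i)) unsplitK.
exists (m + n)%N, (cat _ c c'), (cat _ b b'), (cat _ x x'); split.
  by move=> i; rewrite /cat; case: split.
by rewrite big_split_ord; congr (_ + _); apply: eq_bigr => i _;
  rewrite ?catl ?catr.
Qed.

Lemma dB_X_ract (w : C) (y : X) : dB_X w -> dB_X (w *> y).
Proof.
move=> [n [c [b [x [bB ->]]]]]; exists n, c, b, (fun i => x i * y); split=> //.
by rewrite ract_suml; apply: eq_bigr => i _; rewrite ract_scaler ractA.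
Qed.

(** * Left and right coordinates of 1-forms *)

Definition lform (y1 y2 yp ym : X) : C :=
  y1 *: w1 + y2 *: w2 + yp *: wp + ym *: wm.

(** Right coordinates on the span of ω¹, ω⁺ and ω⁻, where the differentials of
    coinvariants lie. *)
Definition rform (y1 yp ym : X) : C := w1 *> y1 + wp *> yp + wm *> ym.

Lemma lformD y1 y2 yp ym z1 z2 zp zm :
  lform y1 y2 yp ym + lform z1 z2 zp zm =
  lform (y1 + z1) (y2 + z2) (yp + zp) (ym + zm).
Proof.
rewrite /lform !scalerDl [LHS]addrACA; congr (_ + _).
by rewrite [LHS]addrACA; congr (_ + _); rewrite [LHS]addrACA.
Qed.

Lemma lformM x y1 y2 yp ym :
  x *: lform y1 y2 yp ym = lform (x * y1) (x * y2) (x * yp) (x * ym).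
Proof. by rewrite /lform !scalerDr !scalerA. Qed.

Lemma lform1 y : lform y 0 0 0 = y *: w1.
Proof. by rewrite /lform !scale0r !addr0. Qed.

Lemma lform2 y : lform 0 y 0 0 = y *: w2.
Proof. by rewrite /lform !scale0r !addr0 add0r. Qed.

Lemma lformp y : lform 0 0 y 0 = y *: wp.
Proof. by rewrite /lform !scale0r !addr0 !add0r. Qed.

Lemma lformm y : lform 0 0 0 y = y *: wm.
Proof. by rewrite /lform !scale0r !add0r. Qed.

Lemma rformD y1 yp ym z1 zp zm :
  rform y1 yp ym + rform z1 zp zm = rform (y1 + z1) (yp + zp) (ym + zm).
Proof.
rewrite /rform !ractDr [LHS]addrACA; congr (_ + _).
by rewrite [LHS]addrACA.
Qed.

Lemma rform_ract y1 yp ym x :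
  rform y1 yp ym *> x = rform (y1 * x) (yp * x) (ym * x).
Proof. by rewrite /rform !ractDl !ractA. Qed.

(** The two rows of the fundamental corepresentation enter the calculus only
    through these relations, so both are treated at once. *)
Definition row (a b : X) : Prop :=
  diff_rels d w1 w2 wp wm a b /\ comm_rels w1 w2 wp wm a b.

Lemma row_alpha_beta : row α β. Proof. split; [exact: dX_ab|exact: omega_ab]. Qed.
Lemma row_gamma_delta : row γ δ. Proof. split; [exact: dX_cd|exact: omega_cd]. Qed.

Section Row.
Variables a b : X.
Hypothesis ab : row a b.

(** Moving [a] or [b] leftwards through the four basis forms; together with
    [lformD] and [lformM] this computes left coordinates of any product. *)
Lemma lform_ractl y1 y2 yp ym :
  lform y1 y2 yp ym *> a =
  lform (q^-1 *: (y1 * a) + (q * λ ^+ 2) *: (y2 * a) - (q ^+ 2 - 1) *: (ym * b))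
    (q *: (y2 * a)) (yp * a - λ *: (y2 * b)) (ym * a).
Proof.
have [_ [[e2 _] [em _] [ep _] [e1 _]]] := ab.
rewrite [in LHS]/lform !ractDl !ract_scaler e1 e2 ep em -!scaleNr.
rewrite -!lform1 -!lform2 -!lformp -!lformm !(lformD, lformM).
rewrite !(mulr0, addr0, add0r) -?scaleNr !scalerAr.
by congr lform; rewrite addrC.
Qed.

Lemma lform_ractr y1 y2 yp ym :
  lform y1 y2 yp ym *> b =
  lform (q *: (y1 * b) - (q ^+ 2 - 1) *: (yp * a))
    (q^-1 *: (y2 * b)) (yp * b) (ym * b - λ *: (y2 * a)).
Proof.
have [_ [[_ e2] [_ em] [_ ep] [_ e1]]] := ab.
rewrite [in LHS]/lform !ractDl !ract_scaler e1 e2 ep em -!scaleNr.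
rewrite -!lform1 -!lform2 -!lformp -!lformm !(lformD, lformM).
rewrite !(mulr0, addr0, add0r) -?scaleNr !scalerAr.
by congr lform; rewrite addrC.
Qed.

Lemma dX_lforml : d a = lform (((q - q^-1 - q ^- 2) / (q + 1)) *: a)
    ((q^-1 / (q + 1)) *: a) (- (q ^- 2 *: b)) 0.
Proof.
have [[-> _] _] := ab.
by rewrite /lform scale0r addr0 scaleNr -addrA [- _ + _]addrC addrA.
Qed.

Lemma dX_lformr : d b = lform ((q / (q + 1)) *: b)
    (- ((q ^- 2 / (q + 1)) *: b)) 0 (- (q ^- 2 *: a)).
Proof.
have [[_ ->] _] := ab.
by rewrite /lform scale0r addr0 !scaleNr -addrA [- _ + _]addrC addrA.
Qed.

End Row.

(** * Differentials of coinvariants *)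

(** The ω² coordinates of [d a *> b'] and [a *: d b'] are opposite, since ω²
    commutes with [b'] up to the factor [q^-1] modulo ω⁻.  The
    coefficients are put on the right, where the multiplication of [dB.X] by [X]
    acts on them. *)
Lemma dX_rowM a b a' b' : row a b -> row a' b' ->
  d (a * b') = rform (- λ *: (a * b' + q^-1 *: (b * a')))
                     (- q ^- 2 *: (b * b')) (- q^-1 *: (a * a')).
Proof.
move=> ab ab'; have q1 := q1_neq0.
rewrite dXM (dX_lforml ab) (dX_lformr ab') (lform_ractr ab') lformM lformD.
rewrite /rform !(ractZr, ractDr) -!(ractA).
(* Both sides are compared through their left coordinates. *)
rewrite -[w1]scale1r -[wp]scale1r -[wm]scale1r -!lform1 -!lformp -!lformm.
rewrite !(lform_ractl ab, lform_ractl ab', lform_ractr ab, lform_ractr ab').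
rewrite !(lformM, lformD).
rewrite !(mul1r, mul0r, mulr0, scaler0, addr0, add0r, oppr0, subr0).
rewrite -!scalerAl !mul1r.
congr lform; rewrite ?mulrN -?scalerAr ?mulr1.
- set u := a * b'; set v := b * a'.
  rewrite !(lin2l u v) !(lin2r u v) !(lin2Z, lin2N, lin2D).
  by congr lin2; field; rewrite q_neq0.
- rewrite scalerA -scaleNr -scalerDl [X in X *: _](_ : _ = 0) ?scale0r //.
  by field; rewrite q1 q_neq0.
- by rewrite scalerA; congr (_ *: _); field; rewrite ?q_neq0.
- rewrite scalerA -!scaleNr -scalerDl; congr (_ *: _).
  by field; rewrite ?q1 ?q_neq0.
Qed.

Lemma coinvariantM x y (h k : laurent K) :
  rho x = tens x h -> rho y = tens y k -> h * k = 1 -> coinvariant (x * y : X).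
Proof.
move=> rx ry hk; rewrite /coinvariant [LHS]rmorphM.
by rewrite [X in X * _]rx [X in _ * X]ry tensM hk.
Qed.

Lemma coinvariant_products :
  [/\ coinvariant (α * β), coinvariant (α * δ),
      coinvariant (γ * β) & coinvariant (γ * δ)].
Proof.
have [ra rb rc rd] := rho_generators q.
split; [exact: coinvariantM ra rb (zetaV K) | exact: coinvariantM ra rd (zetaV K)
       | exact: coinvariantM rc rb (zetaV K) | exact: coinvariantM rc rd (zetaV K)].
Qed.

(** * Inversion of the corepresentation matrix *)

(** The four identities [Σ_i t_ij S^-1(t_ki) = δ_jk].  They hold for the inverse
    of the antipode and not for the antipode itself because the coefficients
    stand on the right of the entries [t_ij]. *)
Lemma col1_delta_beta : α * δ + γ * (- (q *: β)) = 1.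
Proof. by rewrite mulrN -scalerAr -SLq2_bc SLq2_det. Qed.

Lemma col2_delta_beta : β * δ + δ * (- (q *: β)) = 0.
Proof. by rewrite mulrN -scalerAr SLq2_bd subrr. Qed.

Lemma col1_gamma_alpha : α * (- (q^-1 *: γ)) + γ * α = 0.
Proof. by rewrite mulrN -scalerAr SLq2_ac scalerA mulVf // scale1r addNr. Qed.

Lemma col2_gamma_alpha : β * (- (q^-1 *: γ)) + δ * α = 1.
Proof.
rewrite mulrN -scalerAr -(SLq2_det q) SLq2_ad scalerBl.
by rewrite addrAC addrA subrK addrC.
Qed.

(** In [d (a * b')] the second row occurs linearly and at the far right, so a
    combination over the two choices of [b'] only sees the contracted columns
    [s] and [t]. *)
Lemma dB_X_contract a b p p' s t : row a b ->
  coinvariant (a * β) -> coinvariant (a * δ) ->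
  α * p + γ * p' = s -> β * p + δ * p' = t ->
  dB_X (rform (- λ *: (a * t + q^-1 *: (b * s)))
              (- q ^- 2 *: (b * t)) (- q^-1 *: (a * s))).
Proof.
move=> ab aβB aδB <- <-.
have := dB_XD (dB_X_ract p (dB_X_d aβB)) (dB_X_ract p' (dB_X_d aδB)).
rewrite (dX_rowM ab row_alpha_beta) (dX_rowM ab row_gamma_delta).
rewrite !rform_ract rformD.
congr (dB_X (rform _ _ _)); rewrite -!scalerAl -!scalerDr; congr (_ *: _).
- by rewrite !mulrDl !mulrDr -!scalerAl !mulrA addrACA scalerDr.
- by rewrite mulrDr !mulrA.
- by rewrite mulrDr !mulrA.
Qed.

Lemma dB_X_row_m a b : row a b -> coinvariant (a * β) -> coinvariant (a * δ) ->
  dB_X (rform (λ *: b) 0 a).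
Proof.
move=> ab aβB aδB.
have := dB_X_contract ab aβB aδB col1_delta_beta col2_delta_beta.
move/(dB_X_ract (- q)%:A); rewrite rform_ract.
congr (dB_X (rform _ _ _)).
- rewrite mulr0 add0r mulr1 -scalerAl -scalerAr mulr1 !scalerA.
  by congr (_ *: _); field.
- by rewrite mulr0 scaler0 mul0r.
- by rewrite mulr1 -scalerAl -scalerAr mulr1 scalerA mulrNN mulVf // scale1r.
Qed.

Lemma dB_X_row_p a b : row a b -> coinvariant (a * β) -> coinvariant (a * δ) ->
  dB_X (rform (q ^+ 2 * λ *: a) b 0).
Proof.
move=> ab aβB aδB.
have := dB_X_contract ab aβB aδB col1_gamma_alpha col2_gamma_alpha.
move/(dB_X_ract (- q ^+ 2)%:A); rewrite rform_ract.
congr (dB_X (rform _ _ _)).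
- rewrite mulr0 scaler0 addr0 mulr1 -scalerAl -scalerAr mulr1 !scalerA.
  by congr (_ *: _); rewrite mulrNN mulrC.
- rewrite mulr1 -scalerAl -scalerAr mulr1 scalerA mulrNN.
  by rewrite mulVf ?expf_neq0 // scale1r.
- by rewrite mulr0 scaler0 mul0r.
Qed.

(** Contraction of the remaining row index. *)
Lemma dB_X_rows y1 yp ym z1 zp zm p p' :
  dB_X (rform y1 yp ym) -> dB_X (rform z1 zp zm) ->
  dB_X (rform (y1 * p + z1 * p') (yp * p + zp * p') (ym * p + zm * p')).
Proof.
move=> Y Z; have := dB_XD (dB_X_ract p Y) (dB_X_ract p' Z).
by rewrite !rform_ract rformD.
Qed.

Lemma dB_X_omegas : [/\ dB_X wm, dB_X wp & dB_X w1].
Proof.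
have [αβ αδ γβ γδ] := coinvariant_products.
have m1 := dB_X_row_m row_alpha_beta αβ αδ.
have m2 := dB_X_row_m row_gamma_delta γβ γδ.
have p1 := dB_X_row_p row_alpha_beta αβ αδ.
have p2 := dB_X_row_p row_gamma_delta γβ γδ.
split.
- have := dB_X_rows δ (- (q *: β)) m1 m2.
  rewrite -!scalerAl -scalerDr col1_delta_beta col2_delta_beta scaler0 !mul0r addr0.
  by rewrite /rform !ract0 ract1 !add0r.
- have := dB_X_rows (- (q^-1 *: γ)) α p1 p2.
  rewrite -!scalerAl -scalerDr col1_gamma_alpha col2_gamma_alpha scaler0.
  rewrite !mul0r addr0.
  by rewrite /rform !ract0 ract1 add0r addr0.
- have := dB_X_rows (- (q^-1 *: γ)) α m1 m2.
  rewrite -!scalerAl -scalerDr col1_gamma_alpha col2_gamma_alpha !mul0r addr0.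
  move/(dB_X_ract (λ^-1)%:A); rewrite rform_ract !mul0r.
  rewrite -scalerAl mul1r scalerA mulfV ?lambda_neq0 // scale1r.
  by rewrite /rform !ract0 ract1 !addr0.
Qed.

End Calculus.

Theorem proposition11p1 (R : realType) (q : R[i]) (q_neq0 : q != 0)
    (q_not_root : forall n : nat, (0 < n)%N -> ~~ n.-unity_root q)
    (C : calculus4D q) :
  [/\ dB_X (omegam C), dB_X (omegap C) & dB_X (omega1 C)].
Proof.
apply: dB_X_omegas => //.
by apply: contraNneq (q_not_root 2 isT) => q2; apply/unity_rootP.
Qed.
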